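(* Let $H=S(G,a,b)$ be a shortest path graph, where $G$ is a reduced graph with respect to $a,b$ and $d(a,b)\ge 2$. Fix an index $i$ with $1\le i<d(a,b)$. Let $\{v_{i_1},v_{i_2},\dots,v_{i_k}\}$ be the set of the $k$ vertices of $G$ at distance $i$ from $a$, and let $E_i$ be the set of all edges $UW\in E(H)$ having difference index $i$. Then: (a) The graph $H\setminus E_i$ obtained by deleting the edges $E_i$ from $H$ is a disjoint union of $k$ graphs (pairwise vertex-disjoint, with no edges between them), $$H\setminus E_i=\bigcup_{j=1}^{k}D_{i_j},$$ where $D_{i_j}\cong S(G,a,v_{i_j})\,\square\,S(G,v_{i_j},b)$ for each $j$. (b) For any two distinct subgraphs $D_{i_j}$ and $D_{i_\ell}$, the edges in $E_i$ between $V(D_{i_j})$ and $V(D_{i_\ell})$ form a partial matching (no two of these edges share an endpoint).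
   Context: Graphs are finite and simple. For a graph $G$ with distinct vertices $a,b$, an $a,b$-geodesic is a path between $a$ and $b$ of length $d(a,b)=d_G(a,b)$. The shortest path graph $S(G,a,b)$ is the graph whose vertices are the $a,b$-geodesics in $G$, two of them being adjacent if and only if the corresponding paths differ in exactly one vertex. If adjacent $U,W$ correspond to $av_1\cdots v_{i-1}v_iv_{i+1}\cdots v_pb$ and $av_1\cdots v_{i-1}v_i'v_{i+1}\cdots v_pb$ with $v_i\ne v_i'$, then $i$ is the difference index of the edge $UW$. The reduced graph $(G,a,b)$ is obtained from $G$ by deleting every edge and vertex that does not occur in any $a,b$-geodesic and contracting every edge that occurs in all $a,b$-geodesics; $G$ is a reduced graph with respect to $a,b$ if its reduced graph $(G,a,b)$ is again $G$. The Cartesian product $H_1\,\square\,H_2$ has vertex set $V(H_1)\times V(H_2)$, with $(x_1,x_2)$ adjacent to $(y_1,y_2)$ if and only if either $x_1=y_1$ and $x_2\sim y_2$, or $x_1\sim y_1$ and $x_2=y_2$. *)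

(* Defs.v *)
From HB Require Import structures.
From mathcomp Require Import all_boot.

Set Implicit Arguments.
Unset Strict Implicit.
Unset Printing Implicit Defensive.

Record sgraph := SGraph {
  vertex :> finType;
  adj : rel vertex;
  adj_sym : symmetric adj;
  adj_irrefl : irreflexive adj }.

Notation "x -- y" := (adj x y) (at level 30, no associativity).

Definition graph_iso (G H : sgraph) : Prop :=
  exists f : G -> H, bijective f /\ {mono f : x y / x -- y >-> x -- y}.

Section Operations.

Variables (G H : sgraph).

Definition induced_adj (S : {set G}) : rel {x : G | x \in S} :=
  fun x y => val x -- val y.

Lemma induced_sym S : symmetric (@induced_adj S).
Proof. by move=> x y; rewrite /induced_adj adj_sym. Qed.

Lemma induced_irrefl S : irreflexive (@induced_adj S).
Proof. by move=> x; rewrite /induced_adj adj_irrefl. Qed.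

Definition induced (S : {set G}) : sgraph :=
  SGraph (@induced_sym S) (@induced_irrefl S).

Definition del_adj (F : {set {set G}}) : rel G :=
  fun x y => (x -- y) && ([set x; y] \notin F).

Lemma del_sym F : symmetric (del_adj F).
Proof. by move=> x y; rewrite /del_adj adj_sym setUC. Qed.

Lemma del_irrefl F : irreflexive (del_adj F).
Proof. by move=> x; rewrite /del_adj adj_irrefl. Qed.

Definition del_edges (F : {set {set G}}) : sgraph :=
  SGraph (del_sym F) (del_irrefl F).

Definition cart_adj : rel (G * H) :=
  fun x y => ((x.1 == y.1) && (x.2 -- y.2)) || ((x.1 -- y.1) && (x.2 == y.2)).

Lemma cart_sym : symmetric cart_adj.
Proof.
by move=> x y; rewrite /cart_adj !(adj_sym y.1, adj_sym y.2) !(eq_sym y.1, eq_sym y.2).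
Qed.

Lemma cart_irrefl : irreflexive cart_adj.
Proof. by move=> x; rewrite /cart_adj !adj_irrefl andbF. Qed.

Definition cartesian : sgraph := SGraph cart_sym cart_irrefl.

End Operations.

Section Geodesics.

Variable G : sgraph.

(* [s] lists all the vertices of the path, both ends included. *)
Definition is_path (x y : G) (s : seq G) : bool :=
  if s is z :: p then
    [&& z == x, path (@adj G) z p, last z p == y & uniq s]
  else false.

(* The least length of a path from x to y. A path has fewer than #|G| edges;
   if there is no path then dist x y = #|G|, so no path has that length. *)
Definition dist (x y : G) : nat :=
  find (fun n => [exists w : n.+1.-tuple G, is_path x y w]) (iota 0 #|G|).

Definition sphere (x : G) (i : nat) : {set G} := [set v | dist x v == i].

(* For x != y a geodesic is listed in the direction from x to y, so that each
   geodesic is represented exactly once. *)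
Definition geodesic (x y : G) := {w : (dist x y).+1.-tuple G | is_path x y w}.

Variables a b : G.

Definition sp_adj : rel (geodesic a b) :=
  fun U W => #|[set j | tnth (val U) j != tnth (val W) j]| == 1.

Lemma sp_sym : symmetric sp_adj.
Proof.
move=> U W; rewrite /sp_adj; congr (#|pred_of_set _| == 1).
by apply/setP=> j; rewrite !inE eq_sym.
Qed.

Lemma sp_irrefl : irreflexive sp_adj.
Proof.
move=> U; rewrite /sp_adj; apply/negbTE.
suff -> : [set j | tnth (val U) j != tnth (val U) j] = set0 by rewrite cards0.
by apply/setP=> j; rewrite !inE eqxx.
Qed.

Definition sp_graph : sgraph := SGraph sp_sym sp_irrefl.

(* Entry 0 of the tuple is a, so entry i is the vertex called v_i in
   a v_1 ... v_p b. *)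
Definition diff_index (U W : sp_graph) (i : nat) : bool :=
  (U -- W) && (nth a (val U) i != nth a (val W) i).

Definition diff_edges (i : nat) : {set {set sp_graph}} :=
  [set [set e.1; e.2] | e : sp_graph * sp_graph & diff_index e.1 e.2 i].

Definition edge_of (s : seq G) : rel G :=
  fun x y => ((x, y) \in zip s (behead s)) || ((y, x) \in zip s (behead s)).

Definition kept_vertices : {set G} :=
  [set x | [exists w : geodesic a b, x \in (val w : seq G)]].

Definition kept_edge : rel G :=
  fun x y => [exists w : geodesic a b, edge_of (val w) x y].

Definition contracted_edge : rel G :=
  fun x y => (x -- y) && [forall w : geodesic a b, edge_of (val w) x y].

Definition blocks : {set {set G}} :=
  [set [set y | connect contracted_edge x y] | x in kept_vertices].

Definition reduced_adj : rel {B : {set G} | B \in blocks} :=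
  fun A B => (A != B) &&
    [exists x in val A, [exists y in val B, kept_edge x y]].

Lemma reduced_sym : symmetric reduced_adj.
Proof.
have kept_sym x y : kept_edge x y = kept_edge y x.
  by apply: eq_existsb => w; rewrite /edge_of orbC.
suff imp A B : reduced_adj A B -> reduced_adj B A.
  by move=> A B; apply/idP/idP; apply: imp.
case/andP=> neAB /exists_inP[x Ax /exists_inP[y By xy]].
rewrite /reduced_adj eq_sym neAB; apply/exists_inP; exists y => //.
by apply/exists_inP; exists x; rewrite // kept_sym.
Qed.

Lemma reduced_irrefl : irreflexive reduced_adj.
Proof. by move=> A; rewrite /reduced_adj eqxx. Qed.

(* Delete what lies on no a,b-geodesic, then contract: the vertices are the
   classes of kept vertices under the contracted edges. *)
Definition reduced_graph : sgraph := SGraph reduced_sym reduced_irrefl.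

Definition is_reduced : Prop := graph_iso reduced_graph G.

End Geodesics.

(* Main.v *)
Require Import Defs.
From mathcomp Require Import all_boot.
From mathcomp Require Import zify.

(* D v is the set of geodesics whose i-th entry is v. Cutting at v turns such a
   geodesic into an a,v-geodesic and a v,b-geodesic; conversely two such geodesics
   can be joined because v, like every vertex of a reduced graph, lies on an
   a,b-geodesic, so that d(a,v) + d(v,b) = d(a,b). The Hamming distance is additive
   under this correspondence, and a sum of two Hamming distances is 1 exactly when
   the pairs are adjacent in the Cartesian product. Finally, a neighbour across an
   edge of difference index i is determined by its i-th entry, hence the matching. *)

Set Implicit Arguments.
Unset Strict Implicit.
Unset Printing Implicit Defensive.

(** * Hamming distance of lists *)

Lemma addn_eq1 m n : (m + n == 1) = (m == 0) && (n == 1) || (m == 1) && (n == 0).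
Proof. by case: m n => [|[|m]] [|[|n]]. Qed.

(** Taken on lists rather than tuples so that it applies to concatenations; [zip] truncates, hence
    the equal-size hypotheses below. *)
Definition hamming (T : eqType) (s t : seq T) : nat :=
  count (fun e => e.1 != e.2) (zip s t).

Lemma hamming_cat (T : eqType) (s1 s2 t1 t2 : seq T) :
  size s1 = size t1 ->
  hamming (s1 ++ s2) (t1 ++ t2) = hamming s1 t1 + hamming s2 t2.
Proof. by move=> sz; rewrite /hamming zip_cat // count_cat. Qed.

Lemma hamming_eq0 (T : eqType) (s t : seq T) :
  size s = size t -> (hamming s t == 0) = (s == t).
Proof.
elim: s t => [|x s IHs] [|y t] //= [sz].
by rewrite eqseq_cons -IHs // /hamming /= addn_eq0 eqb0 negbK.
Qed.

Lemma hamming_tnth (T : eqType) n (s t : n.-tuple T) :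
  #|[set j | tnth s j != tnth t j]| = hamming s t.
Proof.
(* A tuple of length 0 offers no default entry for [nth], hence the separate case. *)
case: n s t => [|n] s t.
  by rewrite [s]tuple0 [t]tuple0; apply: eq_card0 => -[].
pose x0 := thead s.
rewrite /hamming -sum1_count (big_nth (x0, x0)) size_zip !size_tuple minnn.
rewrite big_mkord sum1dep_card; apply: eq_card => j; rewrite !inE.
by rewrite nth_zip ?size_tuple // !(tnth_nth x0).
Qed.

(** The single mismatch is at the head, and then the tails coincide, or it lies in the tails, where
    induction applies. *)
Lemma hamming1_nth (T : eqType) (x0 : T) (s t : seq T) i j :
  size s = size t -> hamming s t = 1 ->
  nth x0 s i != nth x0 t i -> j != i -> nth x0 s j = nth x0 t j.
Proof.
elim: s t i j => [|x s IHs] [|y t] i j //= [sz]; rewrite /hamming /= -/(hamming s t).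
case: eqP => [<-|_]; rewrite ?add0n ?add1n.
  by case: i j => [|i] [|j] //=; rewrite ?eqxx // eqSS => h; apply: IHs.
case=> /eqP; rewrite hamming_eq0 // => /eqP <-.
by case: i j => [|i] [|j] //=; rewrite eqxx.
Qed.

(** Comparing both vertex sets inside a common type, later that of vertex lists, avoids writing maps
    between dependent types; finite choice supplies them. *)
Lemma graph_iso_same_range (G H : sgraph) (T : Type) (f : G -> T) (g : H -> T) :
  injective f -> injective g ->
  (forall x, exists y, f x = g y) -> (forall y, exists x, f x = g y) ->
  (forall x x' y y', f x = g y -> f x' = g y' -> (y -- y') = (x -- x')) ->
  graph_iso G H.
Proof.
move=> fI gI /fin_all_exists[h hP] /fin_all_exists[k kP] adjP.
exists h; split; last by move=> x y; apply: adjP.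
by exists k => [x|y]; [apply: fI; rewrite kP | apply: gI; rewrite -hP].
Qed.

(** * Walks and distances *)

Section Distance.

Variable G : sgraph.
Implicit Types (x y z : G) (p q : seq G).

Lemma dist_le x p : path (@adj G) x p -> dist x (last x p) <= size p.
Proof.
move=> xp; have [p' xp' Up' sub] := shortenP xp.
have lt_p' : size p' < #|G| by rewrite -[(size p').+1]/(size (x :: p')) -(card_uniqP Up') max_card.
have le_p' : size p' <= size p by case/andP: Up' => _ U; apply: uniq_leq_size.
(* Otherwise [find] would have stopped no later than at the length of the shortened path [p']. *)
apply: leq_trans le_p'; rewrite leqNgt; apply/negP => lt.
have := before_find 0 lt; rewrite nth_iota // add0n => /existsP[].
by exists (in_tuple (x :: p')); apply/and4P; split=> //=.
Qed.

(** The walk shortens to a path with fewer than [#|G|] edges, so [find] succeeds and [dist] is not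
    its default value. *)
Lemma dist_walk x p : path (@adj G) x p ->
  exists2 q, path (@adj G) x q & last x q = last x p /\ size q = dist x (last x p).
Proof.
move=> xp.
have lt : dist x (last x p) < #|G|.
  have [p' xp' Up' _] := shortenP xp.
  apply: leq_ltn_trans (dist_le xp') _.
  by rewrite -[(size p').+1]/(size (x :: p')) -(card_uniqP Up') max_card.
have := nth_find 0 (a := fun n => [exists w : n.+1.-tuple G, is_path x (last x p) w]) (s := iota 0 #|G|).
rewrite has_find size_iota nth_iota // add0n => /(_ lt) /existsP[[[|z q] //= szq]].
rewrite /= eqSS in szq.
by case/and4P=> /eqP-> xq /eqP lq _; exists q => //; split=> //; apply/eqP.
Qed.

(** Shortest walks replacing the two pieces again form a walk, which cannot be shorter than
    [p ++ q]; so both pieces were already shortest. *)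
Lemma dist_cat x p q :
  path (@adj G) x (p ++ q) -> size (p ++ q) = dist x (last x (p ++ q)) ->
  dist x (last x p) = size p /\ dist (last x p) (last x (p ++ q)) = size q.
Proof.
rewrite cat_path last_cat size_cat => /andP[xp zq] sz.
have [p' xp' [lp' szp']] := dist_walk xp; have [q' zq' [lq' szq']] := dist_walk zq.
have := dist_le (x := x) (p := p' ++ q').
rewrite cat_path last_cat size_cat lp' lq' xp' zq' => /(_ isT).
by have := dist_le xp; have := dist_le zq; lia.
Qed.

(** * Geodesics as vertex lists *)

Lemma geodesicE x y (W : geodesic x y) :
  exists2 p, val W = x :: p :> seq G &
    [/\ path (@adj G) x p, last x p = y & size p = dist x y].
Proof.
case: W => [[[|z p] //= szp]] /= /and4P[/eqP ez xp /eqP lp _].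
by exists p; rewrite ez // in xp lp *; split=> //; apply/eqP.
Qed.

(** A repeated vertex could be cut out, giving a walk shorter than the distance; so a shortest walk
    is a path. *)
Lemma geodesic_walk x y p :
    path (@adj G) x p -> last x p = y -> size p = dist x y ->
  exists W : geodesic x y, val W = x :: p :> seq G.
Proof.
move=> xp lp szp.
have U : uniq (x :: p).
  move: lp; have [p' xp' Up' sub] := shortenP xp => lp'.
  apply: leq_size_uniq Up' _ _.
    by move=> z; rewrite !inE => /orP[->//|/sub->]; rewrite orbT.
  by rewrite /= ltnS szp -lp' dist_le.
have wP : is_path x y (x :: p) by apply/and4P; split=> //; apply/eqP.
have sz : size (x :: p) == (dist x y).+1 by rewrite /= szp.
by exists (exist (fun w : (dist x y).+1.-tuple G => is_path x y w) (Tuple sz) wP).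
Qed.

Lemma geodesic_inj x y : injective (fun W : geodesic x y => val W : seq G).
Proof. by move=> U W /val_inj/val_inj. Qed.

Lemma geodesic_size x y (W : geodesic x y) : size (val W : seq G) = (dist x y).+1.
Proof. exact: size_tuple. Qed.

Lemma geodesic_eqE x y (U W : geodesic x y) :
  (U == W) = (hamming (val U : seq G) (val W) == 0).
Proof. by rewrite hamming_eq0 ?geodesic_size // (inj_eq (@geodesic_inj _ _)). Qed.

Lemma sp_adjE x y (U W : sp_graph x y) :
  (U -- W) = (hamming (val U : seq G) (val W) == 1).
Proof. by rewrite -hamming_tnth. Qed.

(** * Cutting and joining geodesics *)

Variables a b : G.

(** Both pieces are shortest by [dist_cat]. Each contains the cut vertex, and [behead] drops its
    second copy. *)
Lemma geodesic_split (U : geodesic a b) i (v := nth a (val U) i) : i <= dist a b ->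
  [/\ dist a v = i, dist v b = dist a b - i &
      exists (P : geodesic a v) (Q : geodesic v b),
        val U = (val P : seq G) ++ behead (val Q : seq G) :> seq G].
Proof.
have [p Up [ap lp szp]] := geodesicE U; rewrite {}/v Up => le_i.
(* Entry 0 is [a], so entry [i] is the vertex reached after [i] steps. *)
have -> : nth a (a :: p) i = last a (take i p).
  rewrite (last_nth a) size_takel ?szp // -[_ :: take _ _]/(take i.+1 (a :: p)).
  by rewrite nth_take.
have [] := @dist_cat a (take i p) (drop i p); rewrite ?cat_take_drop ?lp //.
rewrite size_takel ?size_drop ?szp // => d1 d2; split=> //.
move: ap lp; rewrite -{1 2}[p](cat_take_drop i) cat_path last_cat => /andP[ap vq] lq.
have [|P eP] := @geodesic_walk _ _ _ ap erefl; first by rewrite d1 size_takel ?szp.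
have [|Q eQ] := @geodesic_walk _ _ _ vq lq; first by rewrite d2 size_drop szp.
by exists P, Q; rewrite eP eQ /= cat_take_drop.
Qed.

(* The blocks partition the kept vertices, so if G has as many vertices as blocks
   then no vertex was deleted. *)
Lemma is_reduced_kept : is_reduced a b -> kept_vertices a b = setT.
Proof.
case=> f [/bij_eq_card]; rewrite card_sig => card_eq _.
apply/eqP; rewrite eqEcard subsetT cardsT -card_eq.
by apply: leq_trans (leq_imset_card (fun x => [set y | connect (contracted_edge a b) x y]) _).
Qed.

Lemma kept_distD v : v \in kept_vertices a b -> dist a v + dist v b = dist a b.
Proof.
rewrite inE => /existsP[U vU].
have lt_v : index v (val U : seq G) < (dist a b).+1.
  by rewrite -[X in _ < X](geodesic_size U) index_mem.
have [//|d1 d2 _] := @geodesic_split U (index v (val U : seq G)).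
by move: d1 d2; rewrite nth_index // => -> ->; rewrite subnKC.
Qed.

Lemma geodesic_join v (P : geodesic a v) (Q : geodesic v b) :
    dist a v + dist v b = dist a b ->
  exists U : geodesic a b, val U = (val P : seq G) ++ behead (val Q : seq G) :> seq G.
Proof.
move=> dD; have [p -> [ap lp szp]] := geodesicE P; have [q -> [vq lq szq]] := geodesicE Q.
by apply: (geodesic_walk (p := p ++ q)); rewrite ?cat_path ?last_cat ?size_cat ?lp ?ap ?szp ?szq.
Qed.

(** The first pieces have equal length, and the vertex dropped by [behead] is always [v]. *)
Lemma join_inj v :
  injective (fun PQ : cartesian (sp_graph a v) (sp_graph v b) =>
     (val PQ.1 : seq G) ++ behead (val PQ.2 : seq G)).
Proof.
move=> [P Q] [P' Q'] /= /eqP; rewrite eqseq_cat ?geodesic_size //.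
case/andP=> /eqP/geodesic_inj-> eQ; congr pair; apply: geodesic_inj.
have [q eq _] := geodesicE Q; have [q' eq' _] := geodesicE Q'.
by move: eQ; rewrite eq eq' /= => /eqP->.
Qed.

Lemma nth_join v (P : geodesic a v) (s : seq G) :
  nth a ((val P : seq G) ++ s) (dist a v) = v.
Proof.
have [p -> [_ lp szp]] := geodesicE P.
by rewrite nth_cat /= szp leqnn -szp -last_nth.
Qed.

Lemma hamming_join v (P P' : sp_graph a v) (Q Q' : sp_graph v b) :
  hamming ((val P : seq G) ++ behead (val Q : seq G))
          ((val P' : seq G) ++ behead (val Q' : seq G)) =
  hamming (val P : seq G) (val P') + hamming (val Q : seq G) (val Q').
Proof.
rewrite hamming_cat ?geodesic_size //; congr addn.
have [q -> _] := geodesicE Q; have [q' -> _] := geodesicE Q'.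
by rewrite /hamming /= eqxx.
Qed.

(** * Edges of a given difference index *)

Lemma diff_edgesE (U W : sp_graph a b) i :
  ([set U; W] \in diff_edges a b i) = diff_index U W i.
Proof.
apply/imsetP/idP => [[[U' W']]|UW]; last by exists (U, W); rewrite ?inE.
rewrite inE /= => d eS.
have /andP[UW' _] := d; have neUW' : U' != W'.
  by apply: contraTneq UW' => ->; rewrite adj_irrefl.
have : U' \in [set U; W] by rewrite eS set21.
have : W' \in [set U; W] by rewrite eS set22.
(* Equal unordered pairs agree up to swapping, and [diff_index] is symmetric. *)
rewrite !inE => /orP[]/eqP eW /orP[]/eqP eU; subst U' W'.
- by rewrite eqxx in neUW'.
- by rewrite /diff_index adj_sym eq_sym.
- by [].
- by rewrite eqxx in neUW'.
Qed.

Definition through i v : {set sp_graph a b} :=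
  [set U : sp_graph a b | nth a (val U) i == v].

Lemma diff_nth i (U W : sp_graph a b) j :
  diff_index U W i -> j != i -> nth a (val U : seq G) j = nth a (val W : seq G) j.
Proof.
case/andP; rewrite sp_adjE => /eqP h1 ne; apply: hamming1_nth h1 ne.
by rewrite !geodesic_size.
Qed.

(** Away from [i], both [W] and [W'] agree with [U]. *)
Lemma diff_index_inj i (U W W' : sp_graph a b) :
    diff_index U W i -> diff_index U W' i ->
  nth a (val W : seq G) i = nth a (val W' : seq G) i -> W = W'.
Proof.
move=> dW dW' eqi; apply: geodesic_inj; apply: (@eq_from_nth _ a).
  by rewrite !geodesic_size.
move=> j _; have [->//|ne_ji] := eqVneq j i.
by rewrite -(diff_nth dW) // (diff_nth dW').
Qed.

Lemma through_iso v (dD : dist a v + dist v b = dist a b) i (di : dist a v = i) :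
  graph_iso (@induced (del_edges (diff_edges a b i)) (through i v))
            (cartesian (sp_graph a v) (sp_graph v b)).
Proof.
subst i; set i := dist a v.
apply: (@graph_iso_same_range _ _ (seq G)
  (fun U : @induced (del_edges (diff_edges a b i)) (through i v) => val (val U : geodesic a b) : seq G)
  (fun PQ : cartesian (sp_graph a v) (sp_graph v b) =>
     (val PQ.1 : seq G) ++ behead (val PQ.2 : seq G))).
- by move=> U W /geodesic_inj/val_inj.
- exact: join_inj.
- move=> [U vU]; have [|_ _] := @geodesic_split U i; first by rewrite -dD leq_addr.
  have Uv := vU; rewrite inE in Uv; rewrite (eqP Uv) => -[P [Q eU]].
  by exists (P, Q).
- move=> [P Q]; have [U eU] := geodesic_join P Q dD.
  have vU : U \in through i v by rewrite inE eU nth_join.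
  by exists (Sub U vU).
move=> [U vU] [W vW] [P Q] [P' Q'] /= eU eW.
rewrite /induced_adj /= /del_adj diff_edgesE /diff_index.
have [Uv Wv] := (vU, vW); rewrite !inE in Uv Wv.
(* Both geodesics have [v] at entry [i], so no edge between them has been deleted. *)
rewrite (eqP Uv) (eqP Wv) eqxx andbF andbT.
have := hamming_join P P' Q Q'; rewrite -eU -eW sp_adjE => ->.
change ((P == P') && (Q -- Q') || (P -- P') && (Q == Q') =
  (hamming (val P : seq G) (val P') + hamming (val Q : seq G) (val Q') == 1)).
by rewrite !geodesic_eqE !sp_adjE; apply/esym/addn_eq1.
Qed.

(** An edge meeting both classes has one end in each, since no geodesic lies in both; so the end [U]
    determines the [i]-th entry of the other end. *)
Lemma diff_edges_end i v w (F : {set sp_graph a b}) U :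
    v != w -> F \in diff_edges a b i ->
    F :&: through i v != set0 -> F :&: through i w != set0 -> U \in F ->
  exists2 W, F = [set U; W] & diff_index U W i /\
    nth a (val W : seq G) i = if U \in through i v then w else v.
Proof.
move=> ne_vw FE /set0Pn[X /setIP[XF Xv]] /set0Pn[Y /setIP[YF Yw]] UF.
have [W eF] : exists W, F = [set U; W].
  case/imsetP: FE => -[X' Y'] _ /= eF.
  move: UF; rewrite eF !inE => /orP[]/eqP->; first by exists Y'.
  by exists X'; rewrite setUC.
have d : diff_index U W i by rewrite -diff_edgesE -eF.
exists W => //; split=> //; move: XF YF; rewrite eF !inE in Xv Yw *.
case/orP=> /eqP eX /orP[]/eqP eY; subst X Y.
- by rewrite -(eqP Xv) (eqP Yw) eqxx in ne_vw.
- by rewrite (eqP Xv) eqxx (eqP Yw).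
- by rewrite (eqP Yw) eq_sym (negbTE ne_vw) (eqP Xv).
- by rewrite -(eqP Xv) (eqP Yw) eqxx in ne_vw.
Qed.

End Distance.

Theorem theorem13 (G : sgraph) (a b : G) (i : nat)
    (Gred : is_reduced a b) (dab : 2 <= dist a b) (hi : 1 <= i < dist a b) :
  exists D : G -> {set sp_graph a b},
    [/\ \bigcup_(v in sphere a i) D v = [set: sp_graph a b],
        forall v w : G, v \in sphere a i -> w \in sphere a i -> v != w ->
          [disjoint D v & D w],
        forall v w : G, v \in sphere a i -> w \in sphere a i -> v != w ->
          forall U W : del_edges (diff_edges a b i),
            U \in D v -> W \in D w -> ~~ (U -- W)
      & forall v : G, v \in sphere a i ->
          graph_iso (@induced (del_edges (diff_edges a b i)) (D v))
                    (cartesian (sp_graph a v) (sp_graph v b))]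
    /\
    (forall v w : G, v \in sphere a i -> w \in sphere a i -> v != w ->
       trivIset [set F in diff_edges a b i |
                  (F :&: D v != set0) && (F :&: D w != set0)]).
Proof.
have keptD v : dist a v + dist v b = dist a b.
  by apply: kept_distD; rewrite is_reduced_kept.
exists (@through G a b i); split; [split | ].
- apply/setP=> U; rewrite inE; apply/bigcupP; exists (nth a (val U : seq G) i).
    by have [|d _ _] := @geodesic_split _ _ _ U i; [case/andP: hi => _ /ltnW | rewrite inE d].
  by rewrite inE.
- move=> v w _ _ ne_vw; rewrite -setI_eq0; apply/eqP/setP=> U; rewrite !inE.
  by apply: contraNF ne_vw => /andP[/eqP<-].
- move=> v w _ _ ne_vw U W; rewrite !inE => /eqP Uv /eqP Ww.
  (* An edge from [U] to [W] would change entry [i], so it is among the deleted ones. *)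
  by rewrite /= /del_adj diff_edgesE /diff_index Uv Ww ne_vw andbT andbN.
- by move=> v; rewrite inE => /eqP dv; apply: through_iso.
move=> v w _ _ ne_vw; apply/trivIsetP=> F F'.
rewrite !inE => /and3P[FE Fv Fw] /and3P[FE' Fv' Fw']; apply: contraR.
(* Two such edges sharing an end [U] must be equal: their other ends have the same [i]-th entry. *)
rewrite -setI_eq0 => /set0Pn[U /setIP[UF UF']].
have [W -> [d e]] := diff_edges_end ne_vw FE Fv Fw UF.
have [W' -> [d' e']] := diff_edges_end ne_vw FE' Fv' Fw' UF'.
by rewrite (diff_index_inj d d') // e.
Qed.
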